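(* Let $p\geq 5$ be any fixed prime integer and $\ell\geq 1$ any integer. For $c\in\mathbb{Z}_p$ let $\varphi_{(p-1)^\ell,c}$ be defined by $\varphi_{(p-1)^\ell,c}(z)=z^{(p-1)^\ell}+c$ for all $z\in\mathbb{Z}_p$. Then $Y_c(p)=1$ for every $c\equiv 1\pmod{p\mathbb{Z}_p}$, $Y_c(p)=2$ for every $c\in p\mathbb{Z}_p$, and $Y_c(p)=0$ for every $c\equiv -1\pmod{p\mathbb{Z}_p}$.
   Context: $\mathbb{Z}_p$ is the ring of $p$-adic integers, and $Y_c(p):=\#\{z\in\mathbb{Z}_p/p\mathbb{Z}_p : \varphi_{(p-1)^\ell,c}(z)-z\equiv 0\pmod{p\mathbb{Z}_p}\}$. *)

(* Defs.v *)
From HB Require Import structures.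
From mathcomp Require Import all_boot all_order all_algebra.
From mathcomp Require Import ring_quotient.
From mathcomp Require Import finmap.
From mathcomp Require Import mathcomp_extra boolp classical_sets functions cardinality.

Set Implicit Arguments.
Unset Strict Implicit.
Unset Printing Implicit Defensive.

Import GRing.Theory.
Local Open Scope ring_scope.
Local Open Scope quotient_scope.
Local Open Scope classical_set_scope.

(* The p-adic integers are the projective limit of the rings Z/p^(n+1), built  *)
(* as the subring of coherent sequences in their product. Index n carries      *)
(* Z/p^(n+1), so that 'Z_(p ^ n.+1) is the intended ring as soon as 1 < p.     *)
Definition Zpow_prod (p : nat) : Type := forall n : nat, 'Z_(p ^ n.+1)%N.

Section ZpowProd.
Variable p : nat.
Implicit Types x y z : Zpow_prod p.

HB.instance Definition _ := Choice.copy (Zpow_prod p)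
  (forall n : nat, ('Z_(p ^ n.+1)%N : choiceType)).

Let zero : Zpow_prod p := fun n => 0.
Let opp x : Zpow_prod p := fun n => - x n.
Let add x y : Zpow_prod p := fun n => x n + y n.
Let one : Zpow_prod p := fun n => 1.
Let mul x y : Zpow_prod p := fun n => x n * y n.

Let addA : associative add.
Proof. by move=> x y z; apply: functional_extensionality_dep => n; apply: addrA. Qed.
Let addC : commutative add.
Proof. by move=> x y; apply: functional_extensionality_dep => n; apply: addrC. Qed.
Let add0 : left_id zero add.
Proof. by move=> x; apply: functional_extensionality_dep => n; apply: add0r. Qed.
Let addN : left_inverse zero opp add.
Proof. by move=> x; apply: functional_extensionality_dep => n; apply: addNr. Qed.

HB.instance Definition _ :=
  GRing.isZmodule.Build (Zpow_prod p) addA addC add0 addN.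

Let mulA : associative mul.
Proof. by move=> x y z; apply: functional_extensionality_dep => n; apply: mulrA. Qed.
Let mulC : commutative mul.
Proof. by move=> x y; apply: functional_extensionality_dep => n; apply: mulrC. Qed.
Let mul1 : left_id one mul.
Proof. by move=> x; apply: functional_extensionality_dep => n; apply: mul1r. Qed.
Let mulDl : left_distributive mul add.
Proof. by move=> x y z; apply: functional_extensionality_dep => n; apply: mulrDl. Qed.
Let one_neq0 : one != zero.
Proof.
apply/eqP => /(congr1 (fun x : Zpow_prod p => x 0%N)) /eqP.
by rewrite /one /zero oner_eq0.
Qed.

HB.instance Definition _ :=
  GRing.Zmodule_isComNzRing.Build (Zpow_prod p) mulA mulC mul1 mulDl one_neq0.

End ZpowProd.

Section Coherent.
Variable p : nat.

Definition Zpow_red (n : nat) (a : 'Z_(p ^ n.+2)%N) : 'Z_(p ^ n.+1)%N := inZp a.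

Lemma dvdn_Zpow_trunc n :
  ((Zp_trunc (p ^ n.+1)).+2 %| (Zp_trunc (p ^ n.+2)).+2)%N.
Proof.
case: p => [|[|q]]; first by rewrite !exp0n.
  by rewrite !exp1n.
have gt1 m : (1 < q.+2 ^ m.+1)%N.
  by rewrite -[X in (X < _)%N](expn0 q.+2) ltn_exp2l.
by rewrite !Zp_cast ?dvdn_exp2l.
Qed.

Let redM n (m : nat) :
  inZp (m %% (Zp_trunc (p ^ n.+2)).+2) = m%:R :> 'Z_(p ^ n.+1)%N.
Proof. by apply: val_inj; rewrite Zp_nat /= modn_dvdm // dvdn_Zpow_trunc. Qed.

Lemma Zpow_redD n : {morph @Zpow_red n : a b / a + b}.
Proof. by move=> a b; rewrite /Zpow_red /= redM natrD !Zp_nat. Qed.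

Lemma Zpow_redM n : {morph @Zpow_red n : a b / a * b}.
Proof. by move=> a b; rewrite /Zpow_red /= redM natrM !Zp_nat. Qed.

Lemma Zpow_red1 n : @Zpow_red n 1 = 1.
Proof. by apply: val_inj; rewrite /= !modn_small. Qed.

Lemma Zpow_redN n : {morph @Zpow_red n : a / - a}.
Proof.
move=> a; apply: (addIr (Zpow_red a)); rewrite -Zpow_redD !addNr.
by apply: val_inj; rewrite /= mod0n.
Qed.

Definition coherent : {pred Zpow_prod p} :=
  [pred x : Zpow_prod p | `[< forall n, Zpow_red (x n.+1) = x n >]].

Lemma coherentP (x : Zpow_prod p) :
  reflect (forall n, Zpow_red (x n.+1) = x n) (x \in coherent).
Proof. exact: asboolP. Qed.

Lemma coherent_subring_closed : subring_closed coherent.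
Proof.
split=> [|x y /coherentP xP /coherentP yP|x y /coherentP xP /coherentP yP];
  apply/coherentP => n.
- exact: Zpow_red1.
- by rewrite -[RHS]/(x n - y n) -xP -yP -Zpow_redN -Zpow_redD.
- by rewrite -[RHS]/(x n * y n) -xP -yP -Zpow_redM.
Qed.

End Coherent.

Arguments coherent : clear implicits.

Record padic_int (p : nat) : Type := PadicInt {
  padic_seq : Zpow_prod p;
  padic_seqP : padic_seq \in coherent p
}.

HB.instance Definition _ (p : nat) := [isSub for @padic_seq p].
HB.instance Definition _ (p : nat) := [Choice of padic_int p by <:].
HB.instance Definition _ (p : nat) :=
  GRing.SubChoice_isSubComNzRing.Build (Zpow_prod p) (coherent p) (padic_int p)
    (@coherent_subring_closed p).

Definition pZp (p : nat) : {pred padic_int p} :=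
  [pred x : padic_int p | `[< exists y : padic_int p, x = p%:R * y >]].

Arguments pZp : clear implicits.

Lemma pZpP (p : nat) (x : padic_int p) :
  reflect (exists y : padic_int p, x = p%:R * y) (x \in pZp p).
Proof. exact: asboolP. Qed.

Lemma pZp_zmod_closed (p : nat) : zmod_closed (pZp p).
Proof.
split=> [|x y /pZpP[a ->] /pZpP[b ->]]; apply/pZpP.
  by exists 0; rewrite mulr0.
by exists (a - b); rewrite mulrBr.
Qed.

HB.instance Definition _ (p : nat) :=
  GRing.isZmodClosed.Build (padic_int p) (pZp p) (@pZp_zmod_closed p).

Lemma pZp_mulr (p : nat) (x y : padic_int p) : y \in pZp p -> x * y \in pZp p.
Proof. by move=> /pZpP[a ->]; apply/pZpP; exists (x * a); rewrite mulrCA. Qed.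

Notation padic_residue p := {ideal_quot (pZp p)}.

Lemma pZp_coord0 (p : nat) (x : padic_int p) :
  prime p -> padic_seq x 0%N = 0 -> x \in pZp p.
Proof.
move=> p_pr x0; have p_gt0 := prime_gt0 p_pr.
have gt1 m : (1 < p ^ m.+1)%N.
  by rewrite -[X in (X < _)%N](expn0 p) ltn_exp2l // prime_gt1.
pose a n : nat := padic_seq x n.
have a_mod n : (a n.+1 %% p ^ n.+1)%N = a n.
  have /coherentP/(_ n)/(congr1 (@nat_of_ord _)) := padic_seqP x.
  by rewrite /= [X in (_ %% X)%N = _ -> _]Zp_cast.
have p_dvd n : (p %| a n)%N.
  elim: n => [|n IHn]; first by rewrite /a x0.
  rewrite (divn_eq (a n.+1) (p ^ n.+1)) a_mod dvdn_addl //.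
  by rewrite dvdn_mull // dvdn_exp.
pose y : Zpow_prod p := fun n => inZp (a n.+1 %/ p).
have yP : y \in coherent p.
  apply/coherentP => n; apply: val_inj.
  rewrite /= !Zp_cast // -(a_mod n.+1) modn_dvdm ?dvdn_exp2l //.
  by rewrite [(p ^ n.+2)%N]expnSr -modn_divl modn_mod.
apply/pZpP; exists (PadicInt yP); apply: val_inj.
apply: functional_extensionality_dep => n.
rewrite rmorphM rmorph_nat -[RHS]/((p%:R : Zpow_prod p) n * y n).
have -> m : (m%:R : Zpow_prod p) n = m%:R.
  by elim: m => // m IHm; rewrite -!natr1 -IHm.
by rewrite /y -Zp_nat -natrM mulnC divnK // Zp_nat; apply: val_inj;
   rewrite /= [X in _ = (_ %% X)%N]Zp_cast // a_mod.
Qed.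

Lemma finite_padic_residue (p : nat) :
  prime p -> finite_set [set: padic_residue p].
Proof.
move=> p_pr; pose f (q : padic_residue p) := padic_seq (repr q) 0%N.
suff f_inj : injective f.
  have <- : f @^-1` [set: _] = [set: padic_residue p] by apply/seteqP.
  by apply: finite_preimage => [q r _ _|]; [exact: f_inj | exact: finite_finset].
move=> q r fqr; rewrite -[q]reprK -[r]reprK; apply/eqP.
rewrite -Quotient.idealrBE; apply: pZp_coord0 => //.
by rewrite -[LHS]/(f q - f r) fqr subrr.
Qed.

Definition phi (p l : nat) (c z : padic_int p) : padic_int p :=
  z ^+ ((p - 1) ^ l)%N + c.

Lemma phi_mod (p l : nat) (c x y : padic_int p) :
  x = y %[mod padic_residue p] -> phi l c x = phi l c y %[mod padic_residue p].
Proof.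
move=> /eqP; rewrite -Quotient.idealrBE => xy; apply/eqP.
rewrite -Quotient.idealrBE /phi opprD addrACA subrr addr0.
by rewrite subrXX mulrC pZp_mulr.
Qed.

(* The solutions are counted as residue classes; by phi_mod the choice of the  *)
(* representative z is irrelevant. Since fset_set sends infinite sets to fset0, *)
(* this is the true cardinality only because of finite_padic_residue.          *)
Definition Y (p l : nat) (c : padic_int p) : nat :=
  #|` fset_set [set \pi_(padic_residue p) z | z in
        [set z : padic_int p | phi l c z - z = 0 %[mod padic_residue p]]]|%fset.

(* Main.v *)
Require Import Defs.
From HB Require Import structures.
From mathcomp Require Import all_boot all_order all_algebra ring_quotient.
From mathcomp Require Import cyclic finmap.
From mathcomp Require Import classical_sets cardinality.

Set Implicit Arguments.
Unset Strict Implicit.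
Unset Printing Implicit Defensive.

Import GRing.Theory.
Local Open Scope ring_scope.
Local Open Scope quotient_scope.

(** Everything happens in the residue ring, which the coordinate of index 0 of
    a coherent sequence identifies with 'Z_p: this coordinate is a ring morphism
    with kernel the ideal generated by p (lemma [eq_residueE]). By Fermat's
    little theorem the power map z |-> z ^+ (p - 1) ^ l sends nonzero residues
    to 1, and it fixes 0 because its exponent is positive. The congruence
    phi l c z = z thus says either that z and c both reduce to 0, or that z is
    nonzero and reduces to c + 1 (lemma [phi_fixedE]). The first case
    contributes the class of 0 exactly when c reduces to 0, and the second one
    contributes the class of c + 1 exactly when c + 1 does not reduce to 0:
    - for c = 1 only the class of 2 remains, 2 being nonzero since p > 2;
    - for c = 0 the solutions are the classes of 0 and 1;
    - for c = -1 neither case can occur. *)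

(** The codomain reads 'Z_p where the sequence provides 'Z_(p ^ 1): the two are
    convertible, and the former is the one Fermat's theorem speaks of. *)
Definition residue (p : nat) (x : padic_int p) : 'Z_p := padic_seq x 0.

Fact residue_zmod_morphism p : zmod_morphism (@residue p).
Proof. by []. Qed.

Fact residue_monoid_morphism p : monoid_morphism (@residue p).
Proof. by []. Qed.

HB.instance Definition _ p :=
  GRing.isZmodMorphism.Build (padic_int p) 'Z_p (@residue p)
    (@residue_zmod_morphism p).
HB.instance Definition _ p :=
  GRing.isMonoidMorphism.Build (padic_int p) 'Z_p (@residue p)
    (@residue_monoid_morphism p).

Lemma mem_pZpE p (x : padic_int p) :
  prime p -> (x \in pZp p) = (residue x == 0).
Proof.
move=> p_pr; apply/idP/eqP => [/pZpP[y ->]|]; last exact: pZp_coord0.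
by rewrite rmorphM rmorph_nat pchar_Zp ?prime_gt1 // mul0r.
Qed.

Lemma eq_residueE p (x y : padic_int p) :
  prime p -> (x = y %[mod padic_residue p]) <-> (residue x = residue y).
Proof.
move=> p_pr; split=> /eqP xy; apply/eqP; move: xy;
  by rewrite -Quotient.idealrBE mem_pZpE // rmorphB subr_eq0.
Qed.

Lemma Zp_fermat p (a : 'Z_p) : prime p -> a != 0 -> a ^+ (p - 1) = 1.
Proof.
move=> p_pr a_neq0; have p_gt1 := prime_gt1 p_pr.
have a_ltp : (a < p)%N by rewrite -[X in (_ < X)%N](Zp_cast p_gt1) ltn_ord.
have co_ap : coprime a p.
  rewrite coprime_sym prime_coprime // gtnNdvd // lt0n.
  by apply: contraNneq a_neq0 => a0; apply/eqP/val_inj.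
have := Euler_exp_totient co_ap; rewrite totient_prime // -subn1 => a_exp.
rewrite -[a]natr_Zp -natrX; apply/val_inj; rewrite /= Zp_nat /=.
by rewrite [X in (_ %% X)%N = _]Zp_cast // a_exp [X in _ = (_ %% X)%N]Zp_cast.
Qed.

Lemma Zp_fermat_pow p l (a : 'Z_p) :
  prime p -> (1 <= l)%N -> a ^+ ((p - 1) ^ l) = (a != 0)%:R.
Proof.
move=> p_pr l_gt0; have p1_gt0 : (0 < p - 1)%N by rewrite subn_gt0 prime_gt1.
have [->|a_neq0] := eqVneq a 0; first by rewrite expr0n gtn_eqF // expn_gt0 p1_gt0.
by rewrite -(prednK l_gt0) expnS exprM Zp_fermat // expr1n.
Qed.

(** Fermat's little theorem turns the degree (p - 1) ^ l equation into a
    linear one on each of the two pieces z = 0 and z != 0. *)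
Lemma phi_fixedE p l (c z : padic_int p) : prime p -> (1 <= l)%N ->
  (phi l c z - z = 0 %[mod padic_residue p]) <->
  (if residue z == 0 then residue c = 0 else residue z = 1 + residue c).
Proof.
move=> p_pr l_gt0; rewrite eq_residueE // rmorphB rmorphD rmorphXn rmorph0 /=.
rewrite Zp_fermat_pow //; case: eqVneq => [->|_] /=; first by rewrite add0r subr0.
by split=> [/eqP|->]; rewrite ?subrr // subr_eq0 => /eqP.
Qed.

Theorem theorem4p3 (p l : nat) (p_prime : prime p) (p_ge5 : (5 <= p)%N)
    (l_ge1 : (1 <= l)%N) :
  [/\ forall c : padic_int p, c = 1 %[mod padic_residue p] -> Y l c = 1%N,
      forall c : padic_int p, c \in pZp p -> Y l c = 2%N
    & forall c : padic_int p, c = -1 %[mod padic_residue p] -> Y l c = 0%N].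
Proof.
have two_neq0 : 2%:R != 0 :> 'Z_p.
  rewrite -(inj_eq val_inj) Zp_nat /= Zp_cast ?prime_gt1 //.
  by rewrite modn_small // (leq_trans _ p_ge5).
pose S c := [set \pi_(padic_residue p) z | z in
  [set z : padic_int p | phi l c z - z = 0 %[mod padic_residue p]]]%classic.
split=> c.
- move=> /(eq_residueE _ _ p_prime); rewrite rmorph1 => c1.
  suff SE : S c = [set \pi_(padic_residue p) 2%:R]%classic.
    by rewrite /Y -/(S c) SE fset_set1 cardfs1.
  apply/seteqP; split=> [_ [z /= + <-]|_ ->] /=.
    move=> /(phi_fixedE _ _ p_prime l_ge1); rewrite c1.
    case: eqP => _ => [/eqP|z2]; first by rewrite oner_eq0.
    by apply/eq_residueE; rewrite // rmorph_nat.
  exists 2%:R => //; apply/phi_fixedE => //.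
  by rewrite rmorph_nat (negPf two_neq0) c1.
- rewrite mem_pZpE // => /eqP c0.
  suff SE : S c = [set \pi_(padic_residue p) 0; \pi_(padic_residue p) 1]%classic.
    rewrite /Y -/(S c) SE fset_setU ?fset_set1 // cardfs2.
    suff /negPf -> : \pi_(padic_residue p) 0 != \pi_(padic_residue p) 1 by [].
    apply/eqP => /(eq_residueE _ _ p_prime)/eqP.
    by rewrite rmorph0 rmorph1 eq_sym oner_eq0.
  apply/seteqP; split=> [_ [z /= + <-]|_ [|] ->] /=.
  + move=> /(phi_fixedE _ _ p_prime l_ge1); rewrite c0 addr0.
    case: eqP => [z0 _|_ z1]; [left|right]; apply/eq_residueE => //.
  + by exists 0 => //; apply/phi_fixedE; rewrite // rmorph0 eqxx.
  + exists 1 => //; apply/phi_fixedE => //.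
    by rewrite rmorph1 oner_eq0 c0 addr0.
- move=> /(eq_residueE _ _ p_prime); rewrite rmorphN rmorph1 => cN1.
  suff SE : S c = set0 by rewrite /Y -/(S c) SE fset_set0 cardfs0.
  apply/seteqP; split=> // _ [z /= + _].
  move=> /(phi_fixedE _ _ p_prime l_ge1); rewrite cN1 subrr.
  by case: eqP => // _ /eqP; rewrite oppr_eq0 oner_eq0.
Qed.
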